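(* Let $C$ be a contractible globular extension with a pregroupoidal structure and $G$ an $\infty$-groupoid of type $C$. Let $n\ge1$, let $u$ be an $(n-1)$-arrow of $G$ and set $x=s^{n-1}_0(u)$. Then there is a group isomorphism $\pi_n(G,u)\to\pi_n(G,x)$, natural in $G$.
   Context: The globe category $\mathbb{G}$ has objects $D_n$ ($n\ge0$), generated by $\sigma_n,\tau_n\colon D_{n-1}\to D_n$ ($n\ge1$) with $\sigma_{n+1}\sigma_n=\tau_{n+1}\sigma_n$, $\sigma_{n+1}\tau_n=\tau_{n+1}\tau_n$; $\sigma^i_j=\sigma_i\cdots\sigma_{j+1}$, $\tau^i_j=\tau_i\cdots\tau_{j+1}$ (identity if $i=j$). A table of dimensions: integers $i_1,\dots,i_n,i'_1,\dots,i'_{n-1}$ with $i_k>i'_k<i_{k+1}$; dimension = largest entry. In a category $C$ under $\mathbb{G}$, its globular sum is the colimit of $D_{i_1}\xleftarrow{\sigma^{i_1}_{i'_1}}D_{i'_1}\xrightarrow{\tau^{i_2}_{i'_1}}D_{i_2}\leftarrow\cdots\xrightarrow{\tau^{i_n}_{i'_{n-1}}}D_{i_n}$, written $D_{i_1}\amalg_{D_{i'_1}}\cdots\amalg_{D_{i'_{n-1}}}D_{i_n}$. A globular extension is a category under $\mathbb{G}$ with all globular sums. $f,g\colon D_n\to X$ are globularly parallel if $n=0$ or $f\sigma_n=g\sigma_n$, $f\tau_n=g\tau_n$; a lifting of $(f,g)$ is $h\colon D_{n+1}\to X$ with $h\sigma_{n+1}=f$, $h\tau_{n+1}=g$; $(f,g)\colon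 D_n\to S$ is admissible if globularly parallel with $S$ a globular sum of dimension $\le n+1$; $C$ is contractible if every admissible pair has a lifting. An $\infty$-groupoid of type $C$ is a presheaf $G$ on $C$ such that each canonical map $G(D_{i_1}\amalg_{D_{i'_1}}\cdots\amalg_{D_{i'_{n-1}}}D_{i_n})\to G_{i_1}\times_{G_{i'_1}}\cdots\times_{G_{i'_{n-1}}}G_{i_n}$ is bijective, where $G_i=G(D_i)$ ($i$-arrows), $s=G(\sigma_i)$, $t=G(\tau_i)$ (source, target), $s^i_j=G(\sigma^i_j)$, $t^i_j=G(\tau^i_j)$, and the fiber product consists of $(u_1,\dots,u_n)$ with $s^{i_k}_{i'_k}(u_k)=t^{i_{k+1}}_{i'_k}(u_{k+1})$. Morphisms are natural transformations. A pregroupoidal structure on $C$ consists of morphisms $\nabla^i_j\colon D_i\to D_i\amalg_{D_j}D_i$ ($i>j\ge0$), $\kappa_i\colon D_{i+1}\to D_i$, $w^i_j\colon D_i\to D_i$ with $\nabla^i_{i-1}\sigma_i=\epsilon_2\sigma_i$, $\nabla^i_{i-1}\tau_i=\epsilon_1\tau_i$ ($\epsilon_1,\epsilon_2$ the canonical inclusions of the first and second summand), $\nabla^i_j\sigma_i=(\sigma_i\amalg_{D_j}\sigma_i)\nabla^{i-1}_j$, $\nabla^i_j\tau_i=(\tau_i\amalg_{D_j}\tau_i)\nabla^{i-1}_j$ for $j<i-1$, $\kappa_i\sigma_{i+1}=\kappa_i\tau_{i+1}=\mathrm{id}$, $w^i_{i-1}\sigma_i=\tau_i$, $w^i_{i-1}\tau_i=\sigma_i$,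 $w^i_j\sigma_i=\sigma_iw^{i-1}_j$, $w^i_j\tau_i=\tau_iw^{i-1}_j$ for $j<i-1$. It induces on $G$: compositions $v\ast^i_ju=G(\nabla^i_j)(\xi)$ for $s^i_j(v)=t^i_j(u)$, $\xi$ corresponding to $(v,u)$; units $k_i=G(\kappa_i)\colon G_i\to G_{i+1}$, $k^i_j=k_{i-1}\cdots k_j\colon G_j\to G_i$. For $n$-arrows $u,v$, $u\sim v$ if some $(n+1)$-arrow has source $u$ and target $v$ (an equivalence relation). For parallel $(n-1)$-arrows $u,v$, $\pi_n(G,u,v)$ is the set of $n$-arrows from $u$ to $v$ modulo $\sim$; $\pi_n(G,u)=\pi_n(G,u,u)$, a group under the operation induced by $\ast^n_{n-1}$; for an object $x\in G_0$, $\pi_n(G,x)=\pi_n(G,k^{n-1}_0(x))$. *)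

(* Defs.v *)
From HB Require Import structures.
From mathcomp Require Import all_boot.
Set Implicit Arguments. Unset Strict Implicit. Unset Printing Implicit Defensive.

Record Category := {
  Ob :> Type;
  Hom : Ob -> Ob -> Type;
  idC : forall X, Hom X X;
  compC : forall X Y Z, Hom Y Z -> Hom X Y -> Hom X Z;
  comp_id_l : forall X Y (f : Hom X Y), compC (idC Y) f = f;
  comp_id_r : forall X Y (f : Hom X Y), compC f (idC X) = f;
  comp_assoc : forall X Y Z W (h : Hom Z W) (g : Hom Y Z) (f : Hom X Y),
      compC h (compC g f) = compC (compC h g) f }.
Arguments Hom {c}.
Arguments idC {c}.
Arguments compC {c X Y Z}.

(* A category under the globe category G: a functor G -> C, i.e. objects
   D_n and maps satisfying the globular relations (G is presented by these
   generators and relations).  Indexing: [sig n] = sigma_{n+1} : D_n -> D_{n+1}. *)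
Record UnderGlobe (C : Category) := {
  Dn : nat -> C;
  sig : forall n, Hom (Dn n) (Dn n.+1);
  tau : forall n, Hom (Dn n) (Dn n.+1);
  glob_ss : forall n, compC (sig n.+1) (sig n) = compC (tau n.+1) (sig n);
  glob_tt : forall n, compC (sig n.+1) (tau n) = compC (tau n.+1) (tau n) }.
Arguments Dn {C} u n.
Arguments sig {C} u n.
Arguments tau {C} u n.

Section Iterated.
Variables (C : Category) (U : UnderGlobe C).

Fixpoint sgit (d j : nat) : Hom (Dn U j) (Dn U (d + j)) :=
  match d with
  | 0 => idC _
  | d'.+1 => compC (sig U (d' + j)) (sgit d' j)
  end.
Fixpoint tgit (d j : nat) : Hom (Dn U j) (Dn U (d + j)) :=
  match d with
  | 0 => idC _
  | d'.+1 => compC (tau U (d' + j)) (tgit d' j)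
  end.

Definition sgij (i j : nat) (h : j <= i) : Hom (Dn U j) (Dn U i) :=
  eq_rect _ (fun a => Hom (Dn U j) (Dn U a)) (sgit (i - j) j) i (subnK h).
Definition tgij (i j : nat) (h : j <= i) : Hom (Dn U j) (Dn U i) :=
  eq_rect _ (fun a => Hom (Dn U j) (Dn U a)) (tgit (i - j) j) i (subnK h).
End Iterated.
Arguments sgij {C} U i j h.
Arguments tgij {C} U i j h.

(* Tables of dimensions: i_1..i_n are [ti 0 .. ti tl] (so n = tl+1),
   i'_1..i'_{n-1} are [ti' 0 .. ti' (tl-1)]; values outside are unused. *)
Record table := {
  tl : nat;
  ti : nat -> nat;
  ti' : nat -> nat;
  tvalid_l : forall k, k < tl -> ti' k < ti k;
  tvalid_r : forall k, k < tl -> ti' k < ti k.+1 }.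

Definition table_dim (t : table) : nat := \max_(k < (tl t).+1) ti t k.

(* (S, eps) is a colimit of
   D_{i_1} <- D_{i'_1} -> D_{i_2} <- ... -> D_{i_n}  *)
Definition is_globular_sum (C : Category) (U : UnderGlobe C) (t : table)
    (S : C) (eps : forall k, Hom (Dn U (ti t k)) S) : Prop :=
  (forall k (hk : k < tl t),
      compC (eps k) (sgij U _ _ (ltnW (tvalid_l hk)))
      = compC (eps k.+1) (tgij U _ _ (ltnW (tvalid_r hk)))) /\
  (forall (Y : C) (f : forall k, Hom (Dn U (ti t k)) Y),
      (forall k (hk : k < tl t),
          compC (f k) (sgij U _ _ (ltnW (tvalid_l hk)))
          = compC (f k.+1) (tgij U _ _ (ltnW (tvalid_r hk)))) ->
      exists h : Hom S Y,
        (forall k, k <= tl t -> compC h (eps k) = f k) /\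
        (forall h' : Hom S Y, (forall k, k <= tl t -> compC h' (eps k) = f k) -> h' = h)).

Record GlobExt := {
  GCat :> Category;
  GGlobe :> UnderGlobe GCat;
  gsum : table -> GCat;
  geps : forall t k, Hom (Dn GGlobe (ti t k)) (gsum t);
  gsum_colim : forall t, @is_globular_sum GCat GGlobe t (gsum t) (geps t) }.

Section GE.
Variable C : GlobExt.
Local Notation D := (Dn (GGlobe C)).
Local Notation sg := (sig (GGlobe C)).
Local Notation tu := (tau (GGlobe C)).

Definition glob_parallel (n : nat) (X : C) : Hom (D n) X -> Hom (D n) X -> Prop :=
  match n as n0 return Hom (D n0) X -> Hom (D n0) X -> Prop with
  | 0 => fun _ _ => True
  | m.+1 => fun f g => compC f (sg m) = compC g (sg m) /\ compC f (tu m) = compC g (tu m)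
  end.

Definition is_lifting (n : nat) (X : C) (f g : Hom (D n) X) (h : Hom (D n.+1) X) : Prop :=
  compC h (sg n) = f /\ compC h (tu n) = g.

Definition contractible : Prop :=
  forall (n : nat) (t : table) (f g : Hom (D n) (gsum C t)),
    table_dim t <= n.+1 -> glob_parallel f g -> exists h, is_lifting f g h.

(* the table of D_i amalg_{D_j} D_i *)
Definition tab2 (i j : nat) (h : j < i) : table :=
  {| tl := 1; ti := fun _ => i; ti' := fun _ => j;
     tvalid_l := fun _ _ => h; tvalid_r := fun _ _ => h |}.

Definition eps1 i j (h : j < i) : Hom (D i) (gsum C (tab2 h)) := geps C (tab2 h) 0.
Definition eps2 i j (h : j < i) : Hom (D i) (gsum C (tab2 h)) := geps C (tab2 h) 1.

Record pregroupoidal := {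
  nabla : forall i j (h : j < i), Hom (D i) (gsum C (tab2 h));
  kappa : forall i, Hom (D i.+1) (D i);
  wrev : forall i j : nat, Hom (D i) (D i);  (* meaningful for j < i *)
  nabla_s_top : forall m (h : m < m.+1),
      compC (nabla h) (sg m) = compC (eps2 h) (sg m);
  nabla_t_top : forall m (h : m < m.+1),
      compC (nabla h) (tu m) = compC (eps1 h) (tu m);
  (* (sigma_i amalg_{D_j} sigma_i) is the unique map hh below *)
  nabla_s_low : forall m j (h : j < m.+1) (h' : j < m)
      (hh : Hom (gsum C (tab2 h')) (gsum C (tab2 h))),
      compC hh (eps1 h') = compC (eps1 h) (sg m) ->
      compC hh (eps2 h') = compC (eps2 h) (sg m) ->
      compC (nabla h) (sg m) = compC hh (nabla h');
  nabla_t_low : forall m j (h : j < m.+1) (h' : j < m)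
      (hh : Hom (gsum C (tab2 h')) (gsum C (tab2 h))),
      compC hh (eps1 h') = compC (eps1 h) (tu m) ->
      compC hh (eps2 h') = compC (eps2 h) (tu m) ->
      compC (nabla h) (tu m) = compC hh (nabla h');
  kappa_s : forall i, compC (kappa i) (sg i) = idC _;
  kappa_t : forall i, compC (kappa i) (tu i) = idC _;
  wrev_s_top : forall m, compC (wrev m.+1 m) (sg m) = tu m;
  wrev_t_top : forall m, compC (wrev m.+1 m) (tu m) = sg m;
  wrev_s_low : forall m j, j < m -> compC (wrev m.+1 j) (sg m) = compC (sg m) (wrev m j);
  wrev_t_low : forall m j, j < m -> compC (wrev m.+1 j) (tu m) = compC (tu m) (wrev m j) }.

End GE.
Arguments eps1 {C i j} h.
Arguments eps2 {C i j} h.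

Record presheaf (C : Category) := {
  ps_ob :> C -> Type;
  ps_map : forall X Y : C, Hom X Y -> ps_ob Y -> ps_ob X;
  ps_id : forall X (a : ps_ob X), ps_map (idC X) a = a;
  ps_comp : forall X Y Z (g : Hom Y Z) (f : Hom X Y) (a : ps_ob Z),
      ps_map (compC g f) a = ps_map f (ps_map g a) }.
Arguments ps_map {C} p {X Y}.

Unset Implicit Arguments.
Record nat_trans (C : Category) (G H : presheaf C) := {
  nt :> forall X : C, G X -> H X;
  nt_nat : forall (X Y : C) (f : Hom X Y) (a : G Y),
      nt X (ps_map G f a) = ps_map H f (nt Y a) }.
Arguments nat_trans {C}.
Arguments nt {C G H} n X _.
Set Implicit Arguments.

Section Gpd.
Variable C : GlobExt.
Local Notation U := (GGlobe C).
Local Notation D := (Dn (GGlobe C)).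

(* canonical map G(globular sum) -> fiber product is bijective *)
Definition is_infty_groupoid (G : presheaf C) : Prop :=
  forall t : table,
    (forall a b : G (gsum C t),
        (forall k, k <= tl t -> ps_map G (geps C t k) a = ps_map G (geps C t k) b) ->
        a = b) /\
    (forall x : forall k, G (D (ti t k)),
        (forall k (hk : k < tl t),
            ps_map G (sgij U _ _ (ltnW (tvalid_l hk))) (x k)
            = ps_map G (tgij U _ _ (ltnW (tvalid_r hk))) (x k.+1)) ->
        exists a : G (gsum C t), forall k, k <= tl t -> ps_map G (geps C t k) a = x k).

Variable G : presheaf C.

Definition src n : G (D n.+1) -> G (D n) := ps_map G (sig U n).
Definition tgt n : G (D n.+1) -> G (D n) := ps_map G (tau U n).

Definition homot n (a b : G (D n)) : Prop :=
  exists w : G (D n.+1), src w = a /\ tgt w = b.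

Definition loop m (u : G (D m)) (a : G (D m.+1)) : Prop := src a = u /\ tgt a = u.

(* c = v *^i_j u  (relational form of G(nabla^i_j)(xi), xi <-> (v,u)) *)
Definition is_comp (P : pregroupoidal C) i j (h : j < i) (v u c : G (D i)) : Prop :=
  exists xi : G (gsum C (tab2 h)),
    ps_map G (eps1 h) xi = v /\ ps_map G (eps2 h) xi = u /\ c = ps_map G (nabla P h) xi.

Fixpoint kit (P : pregroupoidal C) (m : nat) : G (D 0) -> G (D m) :=
  match m with
  | 0 => fun x => x
  | m'.+1 => fun x => ps_map G (kappa P m') (kit P m' x)
  end.

Definition src0 m (u : G (D m)) : G (D 0) := ps_map G (sgij U m 0 (leq0n m)) u.

(* f (on representatives) induces a group isomorphism
   pi_{m+1}(G,u) -> pi_{m+1}(G,y) *)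
Definition pi_group_iso (P : pregroupoidal C) m (u y : G (D m))
    (f : G (D m.+1) -> G (D m.+1)) : Prop :=
  (forall a, loop u a -> loop y (f a)) /\
  (forall a b, loop u a -> loop u b -> homot a b -> homot (f a) (f b)) /\
  (forall a b, loop u a -> loop u b -> homot (f a) (f b) -> homot a b) /\
  (forall c, loop y c -> exists a, loop u a /\ homot (f a) c) /\
  (forall a b c c', loop u a -> loop u b ->
      is_comp P (ltnSn m) a b c -> is_comp P (ltnSn m) (f a) (f b) c' ->
      homot (f c) c').
End Gpd.

(* Main.v *)
Require Import Defs.
From Stdlib Require Import ClassicalEpsilon.
From HB Require Import structures.
From mathcomp Require Import all_boot.
Set Implicit Arguments. Unset Strict Implicit. Unset Printing Implicit Defensive.

(** A representable presheaf [Hom(-, S)] on [C] is itself an oo-groupoid, so every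
    operation on oo-groupoids that is natural can be applied to universal cells; for [S]
    a globular sum, contractibility of [C] then makes any two parallel results homotopic.
    Call whiskering at level [j] the operation [a |-> k(d) *_j a *_j k(g)] for
    [(j+1)]-arrows [d], [g].
    Whiskering is bijective on homotopy classes of parallel arrows: whiskering back with
    the inverses is a natural operation fixing the boundaries up to dimension [j], and such
    an operation becomes, after whiskering at level [j+1] by coherence arrows, one that
    fixes the boundaries up to dimension [j+1]; one concludes by descending induction,
    since an operation fixing the whole boundary is homotopic to the identity.
    If [f, g : D_m -> D_p] agree on boundaries below dimension [l >= p - 1], whiskering
    successively at levels [l, l+1, ..., m] by liftings carries loops at [f x] to loops at
    [g x]. Applied to the maps representing [k^m_{j+1} y] and [k^m_j (s y)], this moves the
    base point from [u] down to the iterated unit of its [0]-source, one level at a time. *)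

(** * Iterated source, target and unit maps *)

Section IteratedCells.
Variables (C : Category) (U : UnderGlobe C).

Lemma leq_addE j i : j <= i -> exists d, i = d + j.
Proof. by move=> h; exists (i - j); rewrite subnK. Qed.

Lemma sgijE d j (h : j <= d + j) : sgij U (d + j) j h = sgit U d j.
Proof.
by rewrite /sgij; move: (subnK h); rewrite addnK => E; rewrite (eq_irrelevance E erefl).
Qed.

Lemma tgijE d j (h : j <= d + j) : tgij U (d + j) j h = tgit U d j.
Proof.
by rewrite /tgij; move: (subnK h); rewrite addnK => E; rewrite (eq_irrelevance E erefl).
Qed.

Lemma sgijS i j (h : j <= i) (h' : j <= i.+1) :
  sgij U i.+1 j h' = compC (sig U i) (sgij U i j h).
Proof.
have [d e] := leq_addE h; subst i.
by rewrite sgijE (@sgijE d.+1 j h').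
Qed.

Lemma tgijS i j (h : j <= i) (h' : j <= i.+1) :
  tgij U i.+1 j h' = compC (tau U i) (tgij U i j h).
Proof.
have [d e] := leq_addE h; subst i.
by rewrite tgijE (@tgijE d.+1 j h').
Qed.

Lemma sgij_id j (h : j <= j) : sgij U j j h = idC _.
Proof. exact: (@sgijE 0 j h). Qed.

Lemma tgij_id j (h : j <= j) : tgij U j j h = idC _.
Proof. exact: (@tgijE 0 j h). Qed.

End IteratedCells.

Section Cells.
Variables (C : GlobExt) (P : pregroupoidal C).
Local Notation U := (GGlobe C).
Local Notation D := (Dn (GGlobe C)).
Local Notation cell G n := (ps_ob G (Dn (GGlobe C) n)).

Fixpoint kapit (d j : nat) : Hom (D (d + j)) (D j) :=
  match d with
  | 0 => idC _
  | d'.+1 => compC (kapit d' j) (kappa P (d' + j))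
  end.

Definition kapij (i j : nat) (h : j <= i) : Hom (D i) (D j) :=
  eq_rect _ (fun a => Hom (D a) (D j)) (kapit (i - j) j) i (subnK h).

Lemma kapijE d j (h : j <= d + j) : @kapij (d + j) j h = kapit d j.
Proof.
by rewrite /kapij; move: (subnK h); rewrite addnK => E; rewrite (eq_irrelevance E erefl).
Qed.

Lemma kapijS i j (h : j <= i) (h' : j <= i.+1) :
  @kapij i.+1 j h' = compC (kapij h) (kappa P i).
Proof.
have [d e] := leq_addE h; subst i.
by rewrite kapijE (@kapijE d.+1 j h').
Qed.

Lemma kapij_id j (h : j <= j) : kapij h = idC _.
Proof. exact: (@kapijE 0 j h). Qed.

Lemma leq_contra j i : ~ (j <= i) -> i <= j.
Proof. by move/negP; rewrite -ltnNge; apply: ltnW. Qed.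

(* Total versions of the iterated structure maps, which spare us the proofs of
   [j <= i]; out of range they take the only other available value. *)
Definition sgm j i : Hom (D j) (D i) :=
  match (j <= i) =P true with
  | ReflectT h => sgij U i j h
  | ReflectF h => kapij (leq_contra h)
  end.
Definition tgm j i : Hom (D j) (D i) :=
  match (j <= i) =P true with
  | ReflectT h => tgij U i j h
  | ReflectF h => kapij (leq_contra h)
  end.
Definition kpm i j : Hom (D i) (D j) :=
  match (j <= i) =P true with
  | ReflectT h => kapij h
  | ReflectF h => sgij U j i (leq_contra h)
  end.

Lemma sgmE j i (h : j <= i) : sgij U i j h = sgm j i.
Proof. by rewrite /sgm; case: eqP => // h'; rewrite (bool_irrelevance h h'). Qed.
Lemma tgmE j i (h : j <= i) : tgij U i j h = tgm j i.
Proof. by rewrite /tgm; case: eqP => // h'; rewrite (bool_irrelevance h h'). Qed.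
Lemma kpmE i j (h : j <= i) : kapij h = kpm i j.
Proof. by rewrite /kpm; case: eqP => // h'; rewrite (bool_irrelevance h h'). Qed.

Lemma sgmS j i : j <= i -> sgm j i.+1 = compC (sig U i) (sgm j i).
Proof. by move=> h; rewrite -(sgmE h) -(sgmE (leqW h)); apply: sgijS. Qed.
Lemma tgmS j i : j <= i -> tgm j i.+1 = compC (tau U i) (tgm j i).
Proof. by move=> h; rewrite -(tgmE h) -(tgmE (leqW h)); apply: tgijS. Qed.
Lemma kpmS j i : j <= i -> kpm i.+1 j = compC (kpm i j) (kappa P i).
Proof. by move=> h; rewrite -(kpmE h) -(kpmE (leqW h)); apply: kapijS. Qed.
Lemma sgm_id j : sgm j j = idC _.
Proof. by rewrite -(sgmE (leqnn j)) sgij_id. Qed.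
Lemma tgm_id j : tgm j j = idC _.
Proof. by rewrite -(tgmE (leqnn j)) tgij_id. Qed.
Lemma kpm_id j : kpm j j = idC _.
Proof. by rewrite -(kpmE (leqnn j)) kapij_id. Qed.

(** * Cells of a presheaf: boundaries, units, reversal, evaluation *)

Section OnePresheaf.
Variable G : presheaf C.

Definition sr j i (a : cell G i) : cell G j := ps_map G (sgm j i) a.
Definition tr j i (a : cell G i) : cell G j := ps_map G (tgm j i) a.
Definition kk i j (x : cell G j) : cell G i := ps_map G (kpm i j) x.

Lemma srr i (a : cell G i) : sr i a = a.
Proof. by rewrite /sr sgm_id ps_id. Qed.
Lemma trr i (a : cell G i) : tr i a = a.
Proof. by rewrite /tr tgm_id ps_id. Qed.
Lemma kkk i (a : cell G i) : kk i a = a.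
Proof. by rewrite /kk kpm_id ps_id. Qed.

Lemma src_src i (a : cell G i.+2) : src (src a) = src (tgt a).
Proof. by rewrite /src /tgt -!ps_comp glob_ss. Qed.
Lemma tgt_src i (a : cell G i.+2) : tgt (src a) = tgt (tgt a).
Proof. by rewrite /src /tgt -!ps_comp glob_tt. Qed.

Lemma sr_src j i (a : cell G i.+1) : j <= i -> sr j a = sr j (src a).
Proof. by move=> h; rewrite /sr sgmS // ps_comp. Qed.
Lemma tr_tgt j i (a : cell G i.+1) : j <= i -> tr j a = tr j (tgt a).
Proof. by move=> h; rewrite /tr tgmS // ps_comp. Qed.
Lemma sr_tgt j i (a : cell G i.+1) : j < i -> sr j a = sr j (tgt a).
Proof.
case: i a => // i a h; rewrite sr_src; last exact: ltnW.
by rewrite sr_src // src_src -sr_src.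
Qed.
Lemma tr_src j i (a : cell G i.+1) : j < i -> tr j a = tr j (src a).
Proof.
case: i a => // i a h; rewrite tr_tgt; last exact: ltnW.
by rewrite tr_tgt // -tgt_src -tr_tgt.
Qed.
Lemma sr1 i (a : cell G i.+1) : sr i a = src a.
Proof. by rewrite sr_src // srr. Qed.
Lemma tr1 i (a : cell G i.+1) : tr i a = tgt a.
Proof. by rewrite tr_tgt // trr. Qed.

Lemma src_kappa i (a : cell G i) : src (ps_map G (kappa P i) a) = a.
Proof. by rewrite /src -ps_comp kappa_s ps_id. Qed.
Lemma tgt_kappa i (a : cell G i) : tgt (ps_map G (kappa P i) a) = a.
Proof. by rewrite /tgt -ps_comp kappa_t ps_id. Qed.

Lemma kkS i j (x : cell G j) : j <= i -> kk i.+1 x = ps_map G (kappa P i) (kk i x).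
Proof. by move=> h; rewrite /kk kpmS // ps_comp. Qed.
Lemma src_kk i j (x : cell G j) : j <= i -> src (kk i.+1 x) = kk i x.
Proof. by move=> h; rewrite kkS // src_kappa. Qed.
Lemma tgt_kk i j (x : cell G j) : j <= i -> tgt (kk i.+1 x) = kk i x.
Proof. by move=> h; rewrite kkS // tgt_kappa. Qed.

Lemma sr_kk l i j (x : cell G j) : l <= j -> j <= i -> sr l (kk i x) = sr l x.
Proof.
move=> lj; elim: i => [|i IH] ji; first by case: j lj x ji => // _ x _; rewrite kkk.
case: (ltngtP j i.+1) ji => // [ji|<-] _; last by rewrite kkk.
by rewrite sr_src ?src_kk ?IH // (leq_trans lj).
Qed.
Lemma tr_kk l i j (x : cell G j) : l <= j -> j <= i -> tr l (kk i x) = tr l x.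
Proof.
move=> lj; elim: i => [|i IH] ji; first by case: j lj x ji => // _ x _; rewrite kkk.
case: (ltngtP j i.+1) ji => // [ji|<-] _; last by rewrite kkk.
by rewrite tr_tgt ?tgt_kk ?IH // (leq_trans lj).
Qed.

Lemma homot_refl n (a : cell G n) : homot a a.
Proof. by exists (ps_map G (kappa P n) a); rewrite src_kappa tgt_kappa. Qed.

Definition inv n (a : cell G n.+1) : cell G n.+1 := ps_map G (wrev P n.+1 n) a.

Lemma src_inv n (a : cell G n.+1) : src (inv a) = tgt a.
Proof. by rewrite /src /tgt /inv -ps_comp wrev_s_top. Qed.
Lemma tgt_inv n (a : cell G n.+1) : tgt (inv a) = src a.
Proof. by rewrite /src /tgt /inv -ps_comp wrev_t_top. Qed.

Lemma homot_sym n (a b : cell G n) : homot a b -> homot b a.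
Proof. by case=> w [<- <-]; exists (inv w); rewrite src_inv tgt_inv. Qed.

Definition matches t (x : forall k, cell G (ti t k)) (z : G (gsum C t)) : Prop :=
  forall k, k <= tl t -> ps_map G (geps C t k) z = x k.

(* [G phi] applied to the point of [G (gsum t)] with components [x]; if there
   is no such point the value is the irrelevant default [d]. *)
Definition ev t n (phi : Hom (D n) (gsum C t)) (x : forall k, cell G (ti t k))
    (d : cell G n) : cell G n :=
  match excluded_middle_informative (exists z, matches x z) with
  | left e => ps_map G phi (proj1_sig (constructive_indefinite_description _ e))
  | right _ => d
  end.

Definition composable t (x : forall k, cell G (ti t k)) : Prop :=
  forall k, k < tl t -> sr (ti' t k) (x k) = tr (ti' t k) (x k.+1).

Hypothesis HG : is_infty_groupoid G.

Lemma evE t n (phi : Hom (D n) (gsum C t)) x d z :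
  matches x z -> ev phi x d = ps_map G phi z.
Proof.
move=> mz; rewrite /ev; case: excluded_middle_informative => [e|]; last by case; exists z.
case: constructive_indefinite_description => z' /= mz'.
congr ps_map; apply: (HG t).1 => k hk; by rewrite mz' // mz.
Qed.

Lemma matches_ex t x : @composable t x -> exists z, matches x z.
Proof.
move=> cx; have [//|z mz] := (HG t).2 x _; last by exists z.
by move=> k hk; rewrite sgmE tgmE; apply: cx.
Qed.

Lemma matches_composable t x z : @matches t x z -> composable x.
Proof.
move=> mz k hk; rewrite /sr /tr -!mz ?(ltnW hk) // -!ps_comp.
by rewrite -(sgmE (ltnW (tvalid_l hk))) -(tgmE (ltnW (tvalid_r hk))) (gsum_colim C t).1.
Qed.

End OnePresheaf.

(** * Morphisms of presheaves *)

Section Morphism.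
Variables (G G' : presheaf C) (F : nat_trans G G').

Lemma nt_src n (a : cell G n.+1) : F _ (src a) = src (F _ a).
Proof. exact: nt_nat. Qed.
Lemma nt_tgt n (a : cell G n.+1) : F _ (tgt a) = tgt (F _ a).
Proof. exact: nt_nat. Qed.
Lemma nt_sr j n (a : cell G n) : F _ (sr j a) = sr j (F _ a).
Proof. exact: nt_nat. Qed.
Lemma nt_tr j n (a : cell G n) : F _ (tr j a) = tr j (F _ a).
Proof. exact: nt_nat. Qed.
Lemma nt_kk j n (a : cell G n) : F _ (kk j a) = kk j (F _ a).
Proof. exact: nt_nat. Qed.
Lemma nt_inv n (a : cell G n.+1) : F _ (inv a) = inv (F _ a).
Proof. exact: nt_nat. Qed.

Lemma nt_homot n (a b : cell G n) : homot a b -> homot (F _ a) (F _ b).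
Proof. by case=> w [<- <-]; exists (F _ w); rewrite nt_src nt_tgt. Qed.

Hypotheses (HG : is_infty_groupoid G) (HG' : is_infty_groupoid G').

(** Composability of [x] provides a point matching it, whose image under [F] matches [x']; both
    evaluations avoid their defaults, so [d] and [d'] may be unrelated. *)
Lemma nt_ev t n (phi : Hom (D n) (gsum C t)) x d x' d' :
  composable x -> (forall k, k <= tl t -> x' k = F _ (x k)) ->
  F _ (ev phi x d) = ev phi x' d'.
Proof.
move=> cx ex; have [z mz] := matches_ex HG cx.
have mz' : matches x' (F _ z).
  by move=> k hk; rewrite ex // -nt_nat mz.
by rewrite (evE HG _ _ mz) (evE HG' _ _ mz') nt_nat.
Qed.

End Morphism.

(** * Representable presheaves *)

Section Yoneda.
Variable S : C.

Definition yo : presheaf C.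
Proof.
refine {| ps_ob := fun X => Hom X S; ps_map := fun X Y f a => compC a f |}.
- by move=> X a; apply: comp_id_r.
- by move=> X Y Z g f a; apply: comp_assoc.
Defined.

(** For maps into [S], uniqueness in the universal property of a globular sum is injectivity of the
    canonical map, and existence is its surjectivity. *)
Lemma yo_infty_groupoid : is_infty_groupoid yo.
Proof.
move=> t; split=> [a b ab|x cx].
  have [|h [_ uh]] := (gsum_colim C t).2 S (fun k => compC a (geps C t k)).
    by move=> k hk; rewrite -!comp_assoc (gsum_colim C t).1.
  rewrite (uh a) // (uh b) // => k hk; by rewrite [RHS]ab.
have [h [mh _]] := (gsum_colim C t).2 S x cx; by exists h.
Qed.

Definition yo_pt (G : presheaf C) (z : G S) : nat_trans yo G.
Proof.
refine {| nt := fun X (f : yo X) => ps_map G f z |}.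
by move=> X Y f a; apply: ps_comp.
Defined.

End Yoneda.

(** The identity of [gsum C t], seen as a point of its own representable presheaf, has the
    inclusions as components. *)
Lemma composable_geps t : composable (G := yo (gsum C t)) (geps C t).
Proof.
apply: (@matches_composable (yo (gsum C t)) t _ (idC (gsum C t))) => k hk /=; exact: comp_id_l.
Qed.


(** * Composition of arrows *)

Section Composition.
Variable G : presheaf C.

(** A total function in place of the relation [is_comp]; outside [j < i], or on a non-composable
    pair, its value is the default [v]. *)
Definition comp j i (v u : cell G i) : cell G i :=
  match (j < i) =P true with
  | ReflectT h => @ev G (tab2 h) i (nabla P h) (fun k : nat => if k is 0 then v else u) v
  | ReflectF _ => v
  end.

Hypothesis HG : is_infty_groupoid G.

Lemma comp_eval j i (h : j < i) (v u : cell G i) (z : G (gsum C (tab2 h))) :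
  ps_map G (eps1 h) z = v -> ps_map G (eps2 h) z = u ->
  comp j v u = ps_map G (nabla P h) z.
Proof.
move=> zv zu; rewrite /comp; case: eqP => // h'.
rewrite (bool_irrelevance h' h); apply: (evE HG).
by case=> [|[|k]] //.
Qed.

Lemma comp_point j i (h : j < i) (v u : cell G i) : sr j v = tr j u ->
  exists z : G (gsum C (tab2 h)), ps_map G (eps1 h) z = v /\ ps_map G (eps2 h) z = u.
Proof.
move=> vu.
have [|z mz] := @matches_ex G HG (tab2 h) (fun k : nat => if k is 0 then v else u).
  by case=> [|k].
by exists z; split; [apply: (mz 0)|apply: (mz 1)].
Qed.

Lemma src_comp m (v u : cell G m.+1) : src v = tgt u -> src (comp m v u) = src u.
Proof.
move=> vu; have [|z [zv zu]] := @comp_point m m.+1 (ltnSn m) v u.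
  by rewrite sr1 tr1.
by rewrite (comp_eval zv zu) -zu /src -!ps_comp nabla_s_top.
Qed.

Lemma tgt_comp m (v u : cell G m.+1) : src v = tgt u -> tgt (comp m v u) = tgt v.
Proof.
move=> vu; have [|z [zv zu]] := @comp_point m m.+1 (ltnSn m) v u.
  by rewrite sr1 tr1.
by rewrite (comp_eval zv zu) -zv /tgt -!ps_comp nabla_t_top.
Qed.

End Composition.

Lemma eps_composable i j (h : j < i) :
  sr (G := yo (gsum C (tab2 h))) j (eps1 h) = tr (G := yo (gsum C (tab2 h))) j (eps2 h).
Proof. exact: (@composable_geps (tab2 h) 0 isT). Qed.

Section CompositionLow.
Variables (G : presheaf C) (HG : is_infty_groupoid G).

Lemma src_comp_low j i (v u : cell G i.+1) : j < i -> sr j v = tr j u ->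
  src (comp j v u) = comp j (src v) (src u).
Proof.
move=> h' vu; have h : j < i.+1 := ltnW h'.
have [z [zv zu]] := comp_point HG h vu.
pose Y := yo (gsum C (tab2 h)).
pose e1 : cell Y i.+1 := eps1 h; pose e2 : cell Y i.+1 := eps2 h.
(* This [hh] is the amalgam of two copies of [sigma] that [nabla_s_low] asks for: a map out of the
   smaller sum is a point of the oo-groupoid [Y]. *)
have [|hh [h1 h2]] := @comp_point Y (yo_infty_groupoid _) j i h' (src e1) (src e2).
  by rewrite -sr_src ?(ltnW h') // -tr_src // eps_composable.
rewrite (comp_eval HG zv zu) (@comp_eval G HG j i h' _ _ (ps_map G hh z)).
- by rewrite /src -!ps_comp (nabla_s_low P h1 h2).
- by rewrite -ps_comp [compC _ _]h1 -zv /src -ps_comp.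
- by rewrite -ps_comp [compC _ _]h2 -zu /src -ps_comp.
Qed.

Lemma tgt_comp_low j i (v u : cell G i.+1) : j < i -> sr j v = tr j u ->
  tgt (comp j v u) = comp j (tgt v) (tgt u).
Proof.
move=> h' vu; have h : j < i.+1 := ltnW h'.
have [z [zv zu]] := comp_point HG h vu.
pose Y := yo (gsum C (tab2 h)).
pose e1 : cell Y i.+1 := eps1 h; pose e2 : cell Y i.+1 := eps2 h.
have [|hh [h1 h2]] := @comp_point Y (yo_infty_groupoid _) j i h' (tgt e1) (tgt e2).
  by rewrite -sr_tgt // -tr_tgt ?(ltnW h') // eps_composable.
rewrite (comp_eval HG zv zu) (@comp_eval G HG j i h' _ _ (ps_map G hh z)).
- by rewrite /tgt -!ps_comp (nabla_t_low P h1 h2).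
- by rewrite -ps_comp [compC _ _]h1 -zv /tgt -ps_comp.
- by rewrite -ps_comp [compC _ _]h2 -zu /tgt -ps_comp.
Qed.

Lemma sr_comp j i (v u : cell G i) : j < i -> sr j v = tr j u ->
  sr j (comp j v u) = sr j u.
Proof.
elim: i v u => // i IH v u; rewrite ltnS leq_eqVlt => /predU1P[ji|ji] vu.
  by subst j; rewrite !sr1 in vu *; rewrite tr1 in vu; rewrite src_comp.
rewrite sr_src ?(ltnW ji) // src_comp_low // IH // -?sr_src ?(ltnW ji) //.
by rewrite -tr_src.
Qed.

Lemma tr_comp j i (v u : cell G i) : j < i -> sr j v = tr j u ->
  tr j (comp j v u) = tr j v.
Proof.
elim: i v u => // i IH v u; rewrite ltnS leq_eqVlt => /predU1P[ji|ji] vu.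
  by subst j; rewrite !tr1 in vu *; rewrite sr1 in vu; rewrite tgt_comp.
rewrite tr_tgt ?(ltnW ji) // tgt_comp_low // IH // -?tr_tgt ?(ltnW ji) //.
by rewrite -sr_tgt.
Qed.

Lemma homot_trans n (b a c : cell G n) : homot a b -> homot b c -> homot a c.
Proof.
case=> w [<- wb] [w' [w'b <-]]; exists (comp n w' w).
by rewrite src_comp ?tgt_comp ?wb.
Qed.

Lemma is_comp_comp i j (h : j < i) (v u c : cell G i) :
  is_comp P h v u c -> c = comp j v u.
Proof. by case=> z [zv [zu ->]]; rewrite (comp_eval HG zv zu). Qed.

Lemma comp_is_comp i j (h : j < i) (v u : cell G i) :
  sr j v = tr j u -> is_comp P h v u (comp j v u).
Proof.
move=> vu; have [z [zv zu]] := comp_point HG h vu.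
by exists z; split=> //; split=> //; apply: comp_eval.
Qed.

Lemma nt_comp (G' : presheaf C) (HG' : is_infty_groupoid G') (F : nat_trans G G')
  j i (v u : cell G i) : j < i -> sr j v = tr j u ->
  F _ (comp j v u) = comp j (F _ v) (F _ u).
Proof.
move=> h vu; have [z [zv zu]] := comp_point HG h vu.
rewrite (comp_eval HG zv zu) nt_nat (@comp_eval _ HG' j i h _ _ (F _ z)) //.
- by rewrite -zv nt_nat.
- by rewrite -zu nt_nat.
Qed.

End CompositionLow.

(** * Whiskering *)

Section Whiskering.

(** For [i = j.+1] both units are identities, and this is a plain triple composite, used below as
    conjugation. *)
Definition whisk (G : presheaf C) j i (d : cell G j.+1) (a : cell G i) (g : cell G j.+1) :
  cell G i := comp j (kk i d) (comp j a (kk i g)).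

Definition whiskerable (G : presheaf C) j i (d : cell G j.+1) (a : cell G i)
  (g : cell G j.+1) : Prop := src d = tr j a /\ sr j a = tgt g.

Variables (G : presheaf C) (HG : is_infty_groupoid G).

Lemma whisk_composable j i (d : cell G j.+1) (a : cell G i) (g : cell G j.+1) :
  j < i -> whiskerable d a g ->
  sr j a = tr j (kk i g) /\ sr j (kk i d) = tr j (comp j a (kk i g)).
Proof.
move=> ji [da ag].
have E : sr j a = tr j (kk i g) by rewrite tr_kk // tr1.
by split=> //; rewrite tr_comp // sr_kk // sr1.
Qed.

Lemma nt_whisk (G' : presheaf C) (HG' : is_infty_groupoid G') (F : nat_trans G G')
  j i (d : cell G j.+1) (a : cell G i) (g : cell G j.+1) : j < i ->
  whiskerable d a g -> F _ (whisk d a g) = whisk (F _ d) (F _ a) (F _ g).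
Proof.
move=> ji h; have [c1 c2] := whisk_composable ji h.
by rewrite /whisk nt_comp // nt_comp // !nt_kk.
Qed.

Lemma nt_whiskerable (G' : presheaf C) (F : nat_trans G G')
  j i (d : cell G j.+1) (a : cell G i) (g : cell G j.+1) :
  whiskerable d a g -> whiskerable (F _ d) (F _ a) (F _ g).
Proof. by case=> da ag; split; rewrite -?nt_src -?nt_sr -?nt_tr -?nt_tgt ?da ?ag. Qed.

Lemma src_whisk j i (d : cell G j.+1) (a : cell G i.+1) (g : cell G j.+1) : j < i ->
  whiskerable d a g -> src (whisk d a g) = whisk d (src a) g.
Proof.
move=> ji h; have [c1 c2] := whisk_composable (leqW ji) h.
by rewrite /whisk src_comp_low // src_comp_low // !src_kk.
Qed.

Lemma tgt_whisk j i (d : cell G j.+1) (a : cell G i.+1) (g : cell G j.+1) : j < i ->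
  whiskerable d a g -> tgt (whisk d a g) = whisk d (tgt a) g.
Proof.
move=> ji h; have [c1 c2] := whisk_composable (leqW ji) h.
by rewrite /whisk tgt_comp_low // tgt_comp_low // !tgt_kk.
Qed.

Lemma sr_whisk j i (d : cell G j.+1) (a : cell G i) (g : cell G j.+1) : j < i ->
  whiskerable d a g -> sr j (whisk d a g) = src g.
Proof.
move=> ji h; have [c1 c2] := whisk_composable ji h.
by rewrite /whisk sr_comp // sr_comp // sr_kk // sr1.
Qed.

Lemma tr_whisk j i (d : cell G j.+1) (a : cell G i) (g : cell G j.+1) : j < i ->
  whiskerable d a g -> tr j (whisk d a g) = tgt d.
Proof.
move=> ji h; have [c1 c2] := whisk_composable ji h.
by rewrite /whisk tr_comp // tr_kk // tr1.
Qed.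

Lemma whiskerable_src j i (d : cell G j.+1) (a : cell G i.+1) (g : cell G j.+1) :
  j < i -> whiskerable d a g -> whiskerable d (src a) g.
Proof. by move=> ji [da ag]; rewrite /whiskerable -tr_src // -sr_src // ltnW. Qed.

Lemma whiskerable_tgt j i (d : cell G j.+1) (a : cell G i.+1) (g : cell G j.+1) :
  j < i -> whiskerable d a g -> whiskerable d (tgt a) g.
Proof. by move=> ji [da ag]; rewrite /whiskerable -tr_tgt ?(ltnW ji) // -sr_tgt. Qed.

Lemma whiskerable_homot j i (d : cell G j.+1) (w : cell G i.+1) (g : cell G j.+1) :
  j < i -> whiskerable d (src w) g -> whiskerable d w g.
Proof. by move=> ji []; rewrite -tr_src // -sr_src // ltnW. Qed.

Lemma homot_whisk j i (d : cell G j.+1) (a b : cell G i) (g : cell G j.+1) : j < i ->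
  whiskerable d a g -> homot a b -> homot (whisk d a g) (whisk d b g).
Proof.
move=> ji h [w [wa wb]]; rewrite -wa in h; have {}h := whiskerable_homot ji h.
by exists (whisk d w g); rewrite src_whisk // tgt_whisk // wa wb.
Qed.

Definition par n (a b : cell G n.+1) := src a = src b /\ tgt a = tgt b.

Lemma whiskerable_par j n (d : cell G j.+1) (a b : cell G n.+1) (g : cell G j.+1) :
  j <= n -> par a b -> whiskerable d a g -> whiskerable d b g.
Proof.
by move=> jn [sab tab]; rewrite /whiskerable !(tr_tgt _ jn) !(sr_src _ jn) sab tab.
Qed.

End Whiskering.

(** * Liftings from contractibility *)

Section Coherence.
Hypothesis HC : contractible C.

Lemma lift_gsum t n (f g : cell (yo (gsum C t)) n.+1) : table_dim t <= n.+2 -> par f g ->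
  exists w : cell (yo (gsum C t)) n.+2, src w = f /\ tgt w = g.
Proof. by move=> tn [fgs fgt]; apply: HC. Qed.

Definition tab1 (p : nat) : table.
Proof. by refine {| tl := 0; ti := fun _ => p; ti' := fun _ => 0 |}. Defined.

(** [D p] is a retract of the one-term globular sum: the lifting is found in the sum and brought
    back along the retraction [r]. *)
Lemma lift_disk p n (f g : Hom (D n) (D p)) : p <= n.+1 -> glob_parallel f g ->
  exists w : cell (yo (D p)) n.+1, src w = f /\ tgt w = g.
Proof.
move=> pn fg; pose e : Hom (D p) (gsum C (tab1 p)) := geps C (tab1 p) 0.
have [//|r [re _]] := (gsum_colim C (tab1 p)).2 (D p) (fun _ => idC _).
have {}re : compC r e = idC _ by apply: re.
have [||w [wf wg]] := @HC n (tab1 p) (compC e f) (compC e g).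
- by apply/bigmax_leqP.
- case: n f g fg {pn} => // n f g [fgs fgt].
  by split; rewrite -!comp_assoc ?fgs ?fgt.
exists (compC r w); split; rewrite /src /tgt /= -comp_assoc.
  by rewrite wf comp_assoc re comp_id_l.
by rewrite wg comp_assoc re comp_id_l.
Qed.

(** The table of [D_{j+1} amalg_{D_j} D_i amalg_{D_j} D_{j+1}], whose inclusions form the universal
    whiskerable triple. *)
Definition tab3 j i (h : j < i) : table.
Proof.
refine {| tl := 2; ti := fun k => if k == 1 then i else j.+1; ti' := fun _ => j |};
  by move=> k _; case: ifP.
Defined.

Definition triple (G : presheaf C) j i (h : j < i) (d : cell G j.+1) (a : cell G i)
  (g : cell G j.+1) (k : nat) : cell G (ti (tab3 h) k) :=
  match k with 0 => d | 1 => a | _ => g end.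

Lemma triple_composable (G : presheaf C) j i (h : j < i) (d : cell G j.+1) (a : cell G i)
  (g : cell G j.+1) : whiskerable d a g -> composable (triple h d a g).
Proof. by case=> da ag; case=> [|[|k]] //= _; rewrite ?sr1 ?tr1. Qed.

Definition natural3 j i n
    (X : forall G : presheaf C, cell G j.+1 -> cell G i -> cell G j.+1 -> cell G n) : Prop :=
  forall (G G' : presheaf C) (HG : is_infty_groupoid G) (HG' : is_infty_groupoid G')
    (F : nat_trans G G') d a g, whiskerable d a g ->
  F _ (X G d a g) = X G' (F _ d) (F _ a) (F _ g).

(* Two natural operations on whiskerable triples are compared on the universal
   triple, which lives in a globular sum and hence in a contractible presheaf. *)
Lemma natural_lift j l
    (X Y : forall G : presheaf C, cell G j.+1 -> cell G l.+1 -> cell G j.+1 -> cell G l.+1) :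
  j <= l -> natural3 X -> natural3 Y ->
  (forall (G : presheaf C) (HG : is_infty_groupoid G) d a g, whiskerable d a g ->
     par (X G d a g) (Y G d a g)) ->
  exists B : forall G : presheaf C, cell G j.+1 -> cell G l.+1 -> cell G j.+1 -> cell G l.+2,
    natural3 B /\
    forall (G : presheaf C) (HG : is_infty_groupoid G) d a g, whiskerable d a g ->
      src (B G d a g) = X G d a g /\ tgt (B G d a g) = Y G d a g.
Proof.
move=> jl nX nY XY.
have h : j < l.+1 by [].
pose Z := yo (gsum C (tab3 h)).
have HZ : is_infty_groupoid Z := yo_infty_groupoid _.
pose e0 : cell Z j.+1 := geps C (tab3 h) 0.
pose e1 : cell Z l.+1 := geps C (tab3 h) 1.
pose e2 : cell Z j.+1 := geps C (tab3 h) 2.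
have we : whiskerable e0 e1 e2.
  split; first by rewrite -sr1; apply: (@composable_geps (tab3 h) 0 isT).
  by rewrite -tr1; apply: (@composable_geps (tab3 h) 1 isT).
have [|w [ws wt]] := @lift_gsum _ _ _ _ _ (XY Z HZ _ _ _ we).
  by apply/bigmax_leqP => k _ /=; case: ifP; rewrite ltnS // leqW.
(* The unit on [a] is only a default, never reached on a whiskerable triple of an oo-groupoid. *)
pose B G (d : cell G j.+1) (a : cell G l.+1) (g : cell G j.+1) :=
  @ev G (tab3 h) l.+2 w (triple h d a g) (ps_map G (kappa P l.+1) a).
exists B; split.
  move=> G G' HG HG' F d a g da; apply: nt_ev => //; first exact: triple_composable.
  by case=> [|[|k]].
move=> G HG d a g da.
have [z mz] := matches_ex HG (@triple_composable _ _ _ h _ _ _ da).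
have z0 : ps_map G e0 z = d by apply: (mz 0).
have z1 : ps_map G e1 z = a by apply: (mz 1).
have z2 : ps_map G e2 z = g by apply: (mz 2).
(* The triple is the image of the universal one under [yo_pt z], so naturality of [X] and [Y]
   carries the boundary of [w] to the required one. *)
rewrite /B (evE HG _ _ mz); split.
  rewrite /src -ps_comp [compC _ _]ws.
  by rewrite [LHS](nX Z G HZ HG (yo_pt z) _ _ _ we) /= z0 z1 z2.
rewrite /tgt -ps_comp [compC _ _]wt.
by rewrite [LHS](nY Z G HZ HG (yo_pt z) _ _ _ we) /= z0 z1 z2.
Qed.

(** * Bijectivity of whiskering and of operations fixing low boundaries *)

Definition operation j :=
  forall (G : presheaf C) i, cell G j.+1 -> cell G i -> cell G j.+1 -> cell G i.

(* A natural globular operation on the cells of dimension [> l], which is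
   the identity on the boundary in dimension [l]. *)
Record fixes_below j l (Q : operation j) : Prop := {
  fb_nat : forall i, l < i -> natural3 (fun G => Q G i);
  fb_src : forall (G : presheaf C) (HG : is_infty_groupoid G) i d (a : cell G i.+1) g,
    l < i -> whiskerable d a g -> src (Q G _ d a g) = Q G _ d (src a) g;
  fb_tgt : forall (G : presheaf C) (HG : is_infty_groupoid G) i d (a : cell G i.+1) g,
    l < i -> whiskerable d a g -> tgt (Q G _ d a g) = Q G _ d (tgt a) g;
  fb_par : forall (G : presheaf C) (HG : is_infty_groupoid G) d (a : cell G l.+1) g,
    whiskerable d a g -> par (Q G _ d a g) a }.

(* Bijectivity up to homotopy, from the cells parallel to [a0] to the cells
   parallel to [f a0]. *)
Definition bij_at (G : presheaf C) n (f : cell G n.+1 -> cell G n.+1) (a0 : cell G n.+1) :=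
  (forall a b, par a a0 -> par b a0 -> homot (f a) (f b) -> homot a b) /\
  (forall c, par c (f a0) -> exists a, par a a0 /\ homot (f a) c).

Lemma sr_fixes j l Q (G : presheaf C) (HG : is_infty_groupoid G) i d (a : cell G i) g :
  j <= l -> @fixes_below j l Q -> l < i -> whiskerable d a g ->
  sr l.+1 (Q G _ d a g) = Q G _ d (sr l.+1 a) g /\
  tr l.+1 (Q G _ d a g) = Q G _ d (tr l.+1 a) g.
Proof.
move=> jl fQ; elim: i a => // i IH a; rewrite ltnS leq_eqVlt => /predU1P[li|li] da.
  by subst i; rewrite !srr !trr.
have ji := leq_ltn_trans jl li.
have [IH1 _] := IH (src a) li (whiskerable_src ji da).
have [_ IH2] := IH (tgt a) li (whiskerable_tgt ji da).
split; first by rewrite sr_src // (fb_src fQ) // IH1 -sr_src.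
by rewrite tr_tgt // (fb_tgt fQ) // IH2 -tr_tgt.
Qed.

Lemma whiskerable_sr j l (G : presheaf C) i d (a : cell G i) (g : cell G j.+1) :
  j <= l -> l < i -> whiskerable d a g -> whiskerable d (sr l.+1 a) g.
Proof.
move=> jl; elim: i a => // i IH a; rewrite ltnS leq_eqVlt => /predU1P[li|li] da.
  by subst i; rewrite srr.
by rewrite sr_src //; apply: IH => //; apply: whiskerable_src => //; apply: leq_ltn_trans li.
Qed.

Lemma whiskerable_tr j l (G : presheaf C) i d (a : cell G i) (g : cell G j.+1) :
  j <= l -> l < i -> whiskerable d a g -> whiskerable d (tr l.+1 a) g.
Proof.
move=> jl; elim: i a => // i IH a; rewrite ltnS leq_eqVlt => /predU1P[li|li] da.
  by subst i; rewrite trr.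
by rewrite tr_tgt //; apply: IH => //; apply: whiskerable_tgt => //; apply: leq_ltn_trans li.
Qed.

(** In dimension [l.+1], [Q] and the projection to the middle cell are natural operations with
    parallel values, so [natural_lift] joins them. *)
Lemma fixes_homot j l Q (G : presheaf C) (HG : is_infty_groupoid G) d
  (a : cell G l.+1) g : j <= l -> @fixes_below j l Q -> whiskerable d a g ->
  homot (Q G _ d a g) a.
Proof.
move=> jl fQ da.
have [|||B [nB BE]] := @natural_lift j l (fun G => Q G l.+1) (fun G _ a _ => a) jl.
- exact: (fb_nat fQ).
- by [].
- by move=> *; apply: (fb_par fQ).
by exists (B G d a g); apply: BE.
Qed.

(** Here [r] is the distance from the level [j] (in [fixes_bij], from [l]) up to [m]. The two
    families are proved together by induction on [r], for all levels at once. *)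
Definition whisk_bij r := forall j m, m = r + j ->
  forall (G : presheaf C) (HG : is_infty_groupoid G) (d : cell G j.+1) (a0 : cell G m.+1)
    (g : cell G j.+1), whiskerable d a0 g -> bij_at (fun a => whisk d a g) a0.

Definition fixes_bij r := forall j l m Q, m = r + l -> j <= l -> @fixes_below j l Q ->
  forall (G : presheaf C) (HG : is_infty_groupoid G) (d : cell G j.+1) (a0 : cell G m.+1)
    (g : cell G j.+1), whiskerable d a0 g -> bij_at (fun a => Q G _ d a g) a0.

Lemma par_sym (G : presheaf C) n (a b : cell G n.+1) : par a b -> par b a.
Proof. by case. Qed.
Lemma par_trans (G : presheaf C) n (b a c : cell G n.+1) : par a b -> par b c -> par a c.
Proof. by rewrite /par => -[-> ->]. Qed.

Lemma par_whisk (G : presheaf C) (HG : is_infty_groupoid G) j n (d : cell G j.+1)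
  (a b : cell G n.+1) (g : cell G j.+1) : j <= n -> whiskerable d a g -> par a b ->
  par (whisk d a g) (whisk d b g).
Proof.
move=> jn da ab; have db := whiskerable_par jn ab da; case: ab => sab tab.
move: jn; rewrite leq_eqVlt => /predU1P[jn|jn].
  by subst j; split; rewrite -?sr1 -?tr1 ?sr_whisk ?tr_whisk.
by split; rewrite ?src_whisk ?tgt_whisk ?sab ?tab.
Qed.

(** Here [m = l], and [Q] is homotopic to the identity on the cells parallel to [a0]; each [c] is
    its own preimage up to homotopy. *)
Lemma fixes_bij0 : fixes_bij 0.
Proof.
move=> j l m Q ->; rewrite add0n => jl fQ G HG d a0 g da0.
have Qa a : par a a0 -> homot (Q G _ d a g) a.
  move=> aa; apply: fixes_homot => //; exact: whiskerable_par (par_sym aa) da0.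
split=> [a b aa ba ab|c ca].
  apply: (homot_trans HG (homot_sym (Qa a aa))).
  exact: (homot_trans HG ab (Qa b ba)).
have {}ca := par_trans ca (fb_par fQ HG da0).
by exists c; split=> //; apply: Qa.
Qed.

Lemma whiskerable_inv (G : presheaf C) (HG : is_infty_groupoid G) j i (d : cell G j.+1)
  (a : cell G i) g : j < i -> whiskerable d a g ->
  whiskerable (inv d) (whisk d a g) (inv g).
Proof. by move=> ji h; split; rewrite ?src_inv ?tgt_inv ?tr_whisk ?sr_whisk. Qed.

Definition unwhisk j : operation j := fun G i d a g => whisk (inv d) (whisk d a g) (inv g).

(** [inv] exchanges source and target, so the second whiskering restores the [j]-dimensional
    boundary of [a] strictly. *)
Lemma unwhisk_fixes j : fixes_below j (@unwhisk j).
Proof.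
split.
- move=> i ji G G' HG HG' F d a g h.
  rewrite /unwhisk nt_whisk ?nt_whisk ?nt_inv //; exact: whiskerable_inv.
- move=> G HG i d a g ji h; rewrite /unwhisk !src_whisk //.
  by apply: whiskerable_inv => //; apply: leqW.
- move=> G HG i d a g ji h; rewrite /unwhisk !tgt_whisk //.
  by apply: whiskerable_inv => //; apply: leqW.
- move=> G HG d a g h; have hi := whiskerable_inv HG (ltnSn j) h.
  split; first by rewrite -!sr1 sr_whisk // src_inv h.2.
  by rewrite -!tr1 tr_whisk // tgt_inv h.1.
Qed.

(** The hypothesis with [l = j] makes [unwhisk] bijective on classes. Hence whiskering is injective,
    and so is whiskering by the inverses, an instance of the same statement. *)
Lemma fixes_whisk r : fixes_bij r -> whisk_bij r.
Proof.
move=> HQ j m mr.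
have jm : j <= m by rewrite mr leq_addl.
have inj G (HG : is_infty_groupoid G) (d : cell G j.+1) (a0 : cell G m.+1) g :
  whiskerable d a0 g -> forall a b, par a a0 -> par b a0 ->
  homot (whisk d a g) (whisk d b g) -> homot a b.
  move=> da0 a b aa ba ab.
  apply: (HQ j j m _ mr (leqnn j) (unwhisk_fixes j) G HG d a0 g da0).1 => //.
  apply: homot_whisk => //; apply: whiskerable_inv => //.
  exact: whiskerable_par (par_sym aa) da0.
move=> G HG d a0 g da0; split; first exact: inj.
move=> c cW.
have dW := whiskerable_inv HG (jm : j < m.+1) da0.
(* Surjectivity: [c] is whiskered back, a preimage [a] under [unwhisk] is taken, and injectivity of
   whiskering by [inv d], [inv g] compares [whisk d a g] with [c]. *)
have [|a [aa ac]] := (HQ j j m _ mr (leqnn j) (unwhisk_fixes j) G HG d a0 g da0).2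
  (whisk (inv d) c (inv g)).
  by apply: par_whisk => //; apply: whiskerable_par (par_sym cW) dW.
exists a; split=> //.
apply: (inj _ HG _ _ _ dW) => //; apply: par_whisk => //.
exact: whiskerable_par (par_sym aa) da0.
Qed.

Lemma par_fixes j l Q (G : presheaf C) (HG : is_infty_groupoid G) n d
  (a b : cell G n.+1) g : j <= l -> @fixes_below j l Q -> l < n ->
  whiskerable d a g -> par a b -> par (Q G _ d a g) (Q G _ d b g).
Proof.
move=> jl fQ ln da ab.
have db := whiskerable_par (leq_trans jl (ltnW ln)) ab da; case: ab => sab tab.
by split; rewrite ?(fb_src fQ) ?(fb_tgt fQ) ?sab ?tab.
Qed.

(** Correcting [Q] by natural homotopies on its boundary yields an operation fixing one more
    dimension, to which [HQ] applies; the correction is a whiskering at level [l.+1], which [HW]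
    allows to cancel. *)
Lemma fixes_bijS r : fixes_bij r -> whisk_bij r -> fixes_bij r.+1.
Proof.
move=> HQ HW j l m Q mr jl fQ.
have lm : l < m by rewrite mr addSn ltnS leq_addl.
have nQ : natural3 (fun G => Q G l.+1) := fb_nat fQ (ltnSn l).
have nid : natural3 (fun (G : presheaf C) (_ : cell G j.+1) (a : cell G l.+1)
  (_ : cell G j.+1) => a) by [].
have [B [nB BE]] := natural_lift jl nQ nid (fb_par fQ).
have [B' [nB' BE']] : exists B : forall G : presheaf C,
    cell G j.+1 -> cell G l.+1 -> cell G j.+1 -> cell G l.+2,
    natural3 B /\
    forall (G : presheaf C) (HG : is_infty_groupoid G) d a g, whiskerable d a g ->
      src (B G d a g) = a /\ tgt (B G d a g) = Q G _ d a g.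
  apply: (natural_lift jl nid nQ) => G HG d a g da.
  exact: par_sym (fb_par fQ HG da).
(* With boundaries in dimension [l.+1], the composite runs
   [sr a -> Q (sr a) -> Q (tr a) -> tr a]. *)
pose Q' : operation j := fun G i d a g =>
  whisk (B G d (tr l.+1 a) g) (Q G i d a g) (B' G d (sr l.+1 a) g).
have wQ G (HG : is_infty_groupoid G) i d (a : cell G i) g : l < i -> whiskerable d a g ->
    whiskerable (B G d (tr l.+1 a) g) (Q G i d a g) (B' G d (sr l.+1 a) g).
  move=> li da; have [Qs Qt] := sr_fixes HG jl fQ li da.
  split; first by rewrite (BE G HG _ _ _ (whiskerable_tr jl li da)).1.
  by rewrite (BE' G HG _ _ _ (whiskerable_sr jl li da)).2.
have fQ' : fixes_below l.+1 Q'.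
  split.
  - move=> i li G G' HG HG' F d a g da; have li' := ltnW li.
    rewrite /Q' nt_whisk //; last exact: wQ.
    rewrite (nB G G' HG HG' F) ?(nB' G G' HG HG' F) ?(fb_nat fQ li' HG HG' F) //.
    + by rewrite nt_sr nt_tr.
    + exact: whiskerable_sr.
    + exact: whiskerable_tr.
  - move=> G HG i d a g li da; have li' := ltnW li.
    rewrite /Q' src_whisk //; last by apply: wQ => //; apply: leqW.
    by rewrite (fb_src fQ) // (sr_src a li') (tr_src a li).
  - move=> G HG i d a g li da; have li' := ltnW li.
    rewrite /Q' tgt_whisk //; last by apply: wQ => //; apply: leqW.
    by rewrite (fb_tgt fQ) // (sr_tgt a li) (tr_tgt a li').
  - move=> G HG d a g da; have wa := wQ G HG _ d a g (leqnSn l.+1) da.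
    have ws := whiskerable_sr jl (leqnSn l.+1) da.
    have wt := whiskerable_tr jl (leqnSn l.+1) da.
    split; first by rewrite -!sr1 sr_whisk // (BE' G HG _ _ _ ws).1.
    by rewrite -!tr1 tr_whisk // (BE G HG _ _ _ wt).2.
move=> G HG d a0 g da0.
have lm1 : l < m.+1 := leqW lm.
have jm : j <= m := leq_trans jl (ltnW lm).
have mr' : m = r + l.+1 by rewrite mr addSnnS.
(* As [l.+1 <= m], cells parallel to [a0] share its boundary in dimension [l.+1]: on them [Q'] is
   [Q] followed by whiskering by fixed arrows. *)
have Q'E a : par a a0 -> Q' G _ d a g =
    whisk (B G d (tr l.+1 a0) g) (Q G _ d a g) (B' G d (sr l.+1 a0) g).
  by case=> sa ta; rewrite /Q' (sr_src a lm) (tr_tgt a lm) sa ta -tr_tgt // -sr_src.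
have [inj sur] := HQ j l.+1 m Q' mr' (leqW jl) fQ' G HG d a0 g da0.
have wa0 := wQ G HG _ _ _ _ lm1 da0.
have da a : par a a0 -> whiskerable d a g.
  by move=> aa; apply: whiskerable_par (par_sym aa) da0.
have pQ a : par a a0 -> par (Q G _ d a g) (Q G _ d a0 g).
  by move=> aa; apply: (par_fixes HG jl fQ lm (da a aa) aa).
split=> [a b aa ba ab|c cQ].
  apply: inj => //; rewrite !Q'E //; apply: homot_whisk => //.
  exact: whiskerable_par (par_sym (pQ a aa)) wa0.
(* The whiskered [c] is reached by [Q'], and the whiskering is then cancelled. *)
have [|a [aa ac]] := sur (whisk (B G d (tr l.+1 a0) g) c (B' G d (sr l.+1 a0) g)).
  by apply: par_whisk => //; apply: whiskerable_par (par_sym cQ) wa0.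
exists a; split=> //; rewrite Q'E // in ac.
by apply: (HW l.+1 m mr' G HG _ _ _ wa0).1 ac; first exact: pQ.
Qed.

Lemma whisk_bijP r : whisk_bij r.
Proof.
apply: fixes_whisk; elim: r => [|r IH]; first exact: fixes_bij0.
by apply: fixes_bijS => //; apply: fixes_whisk.
Qed.

Lemma whisk_bij_at j m (G : presheaf C) (HG : is_infty_groupoid G) (d : cell G j.+1)
  (a0 : cell G m.+1) (g : cell G j.+1) : j <= m -> whiskerable d a0 g ->
  bij_at (fun a => whisk d a g) a0.
Proof. by move=> jm; apply: (@whisk_bijP (m - j)); rewrite // subnK. Qed.

(** * Compatibility of whiskering with composition *)

Lemma gsum_map t (G : presheaf C) (HG : is_infty_groupoid G) (x : forall k, cell G (ti t k)) :
  composable x -> exists F : nat_trans (yo (gsum C t)) G,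
    forall k, k <= tl t -> F _ (geps C t k) = x k.
Proof. by move=> /(matches_ex HG)[z mz]; exists (yo_pt z). Qed.

Lemma loop_par (G : presheaf C) m (u : cell G m) a :
  loop u a <-> par a (ps_map G (kappa P m) u).
Proof. by rewrite /loop /par src_kappa tgt_kappa. Qed.

(** The table of [D_{l+1} amalg_{D_l} D_{m+1} amalg_{D_m} D_{m+1} amalg_{D_l} D_{l+1}], universal
    for two composable arrows with whiskering arrows at both ends. *)
Definition tab4 l m (h : l < m) : table.
Proof.
refine {| tl := 3; ti := fun k => if (k == 1) || (k == 2) then m.+1 else l.+1;
          ti' := fun k => if k == 1 then m else l |}.
- by case=> [|[|[|k]]] //= _; apply: leqW.
- by case=> [|[|[|k]]] //= _; apply: leqW.
Defined.

Lemma whisk_comp_par (G : presheaf C) (HG : is_infty_groupoid G) l m (d g : cell G l.+1)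
  (a b : cell G m.+1) : l < m -> src a = tgt b -> src d = tr l a -> sr l b = tgt g ->
  par (whisk d (comp m a b) g) (comp m (whisk d a g) (whisk d b g)) /\
  [/\ whiskerable d a g, whiskerable d b g, whiskerable d (comp m a b) g
    & src (whisk d a g) = tgt (whisk d b g)].
Proof.
move=> lm ab da bg; have lm' := ltnW lm.
have wa : whiskerable d a g by split=> //; rewrite -bg sr_src // ab -sr_tgt.
have wb : whiskerable d b g by split=> //; rewrite da tr_src // ab -tr_tgt.
have wc : whiskerable d (comp m a b) g.
  by split; rewrite ?da -?bg ?(tr_tgt _ lm') ?(sr_src _ lm') ?src_comp ?tgt_comp.
have sab : src (whisk d a g) = tgt (whisk d b g) by rewrite src_whisk // tgt_whisk // ab.
split; last by [].
by split; rewrite ?src_comp ?tgt_comp // ?src_whisk ?tgt_whisk ?src_comp ?tgt_comp.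
Qed.

(** On the universal quadruple the two sides are parallel and the table has dimension [m.+1], so a
    lifting exists; [F] carries it to [G]. *)
Lemma whisk_comp (G : presheaf C) (HG : is_infty_groupoid G) l m (d g : cell G l.+1)
  (a b : cell G m.+1) : l < m -> src a = tgt b -> src d = tr l a -> sr l b = tgt g ->
  homot (whisk d (comp m a b) g) (comp m (whisk d a g) (whisk d b g)).
Proof.
move=> lm ab da bg.
pose t := tab4 lm; pose Z := yo (gsum C t).
have HZ : is_infty_groupoid Z := yo_infty_groupoid _.
pose e0 : cell Z l.+1 := geps C t 0.
pose e1 : cell Z m.+1 := geps C t 1.
pose e2 : cell Z m.+1 := geps C t 2.
pose e3 : cell Z l.+1 := geps C t 3.
have c0 : src e0 = tr l e1 by rewrite -sr1; apply: (@composable_geps t 0 isT).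
have c1 : src e1 = tgt e2 by rewrite -sr1 -tr1; apply: (@composable_geps t 1 isT).
have c2 : sr l e2 = tgt e3 by rewrite -tr1; apply: (@composable_geps t 2 isT).
pose x k : cell G (ti t k) := match k with 0 => d | 1 => a | 2 => b | _ => g end.
have [|F Fx] := @gsum_map t G HG x.
  by case=> [|[|[|k]]] //= _; rewrite ?sr1 ?tr1.
have F0 : F _ e0 = d by apply: (Fx 0).
have F1 : F _ e1 = a by apply: (Fx 1).
have F2 : F _ e2 = b by apply: (Fx 2).
have F3 : F _ e3 = g by apply: (Fx 3).
have [pe [wa wb wc sab]] := whisk_comp_par HZ lm c1 c0 c2.
have lm' := leqW lm.
have [|w we] := lift_gsum _ pe.
  by apply/bigmax_leqP => k _ /=; case: ifP; rewrite ltnS ?leqnSn // ltnW // ltnW.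
have := nt_homot F (ex_intro _ w we).
rewrite nt_whisk // nt_comp ?sr1 ?tr1 // nt_comp ?sr1 ?tr1 // !nt_whisk //.
by rewrite F0 F1 F2 F3.
Qed.

(** As [tl] counts the gluings, this is the universal string of [n.+1] composable arrows. *)
Definition chain (n m : nat) : table :=
  {| tl := n; ti := fun _ => m.+1; ti' := fun _ => m;
     tvalid_l := fun _ _ => ltnSn m; tvalid_r := fun _ _ => ltnSn m |}.

Lemma lift_chain n m (f g : cell (yo (gsum C (chain n m))) m.+1) :
  par f g -> homot f g.
Proof. by apply: lift_gsum; apply/bigmax_leqP => k _ /=. Qed.

Lemma chain_map n m (G : presheaf C) (HG : is_infty_groupoid G) (x : nat -> cell G m.+1) :
  (forall k, k < n -> src (x k) = tgt (x k.+1)) ->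
  exists F : nat_trans (yo (gsum C (chain n m))) G,
    forall k, k <= n -> F _ (geps C (chain n m) k) = x k.
Proof.
by move=> cx; apply: (@gsum_map (chain n m)) => // k hk; rewrite sr1 tr1; apply: cx.
Qed.

Lemma chain_src_tgt n m k : k < n ->
  src (G := yo (gsum C (chain n m))) (geps C (chain n m) k) =
  tgt (G := yo (gsum C (chain n m))) (geps C (chain n m) k.+1).
Proof. by move=> hk; rewrite -sr1 -tr1; apply: (@composable_geps (chain n m) k). Qed.

Lemma whiskerable_top (G : presheaf C) m (d a g : cell G m.+1) :
  src d = tgt a -> src a = tgt g -> whiskerable d a g.
Proof. by move=> da ag; split; rewrite ?tr1 ?sr1. Qed.

Lemma src_whisk_top (G : presheaf C) (HG : is_infty_groupoid G) m (d a g : cell G m.+1) :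
  src d = tgt a -> src a = tgt g -> src (whisk d a g) = src g.
Proof. by move=> da ag; rewrite -sr1 sr_whisk //; apply: whiskerable_top. Qed.

Lemma tgt_whisk_top (G : presheaf C) (HG : is_infty_groupoid G) m (d a g : cell G m.+1) :
  src d = tgt a -> src a = tgt g -> tgt (whisk d a g) = tgt d.
Proof. by move=> da ag; rewrite -tr1 tr_whisk //; apply: whiskerable_top. Qed.

(** Both sides bracket the same string of six arrows; the right-hand form isolates [comp m x2 x3],
    which [conj_pi_iso] replaces by a unit. *)
Lemma comp_whisk_whisk (G : presheaf C) (HG : is_infty_groupoid G) m
  (x0 x1 x2 x3 x4 x5 : cell G m.+1) :
  src x0 = tgt x1 -> src x1 = tgt x2 -> src x2 = tgt x3 -> src x3 = tgt x4 ->
  src x4 = tgt x5 ->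
  homot (comp m (whisk x0 x1 x2) (whisk x3 x4 x5))
        (whisk x0 (whisk x1 (comp m x2 x3) x4) x5).
Proof.
move=> h0 h1 h2 h3 h4.
pose x k := match k with 0 => x0 | 1 => x1 | 2 => x2 | 3 => x3 | 4 => x4 | _ => x5 end.
have [|F Fx] := @chain_map 5 m G HG x; first by case=> [|[|[|[|[|k]]]]].
pose Z := yo (gsum C (chain 5 m)).
have HZ : is_infty_groupoid Z := yo_infty_groupoid _.
pose e k : cell Z m.+1 := geps C (chain 5 m) k.
have c0 : src (e 0) = tgt (e 1) by apply: chain_src_tgt.
have c1 : src (e 1) = tgt (e 2) by apply: chain_src_tgt.
have c2 : src (e 2) = tgt (e 3) by apply: chain_src_tgt.
have c3 : src (e 3) = tgt (e 4) by apply: chain_src_tgt.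
have c4 : src (e 4) = tgt (e 5) by apply: chain_src_tgt.
have d1 : src (e 1) = tgt (comp m (e 2) (e 3)) by rewrite tgt_comp.
have d2 : src (comp m (e 2) (e 3)) = tgt (e 4) by rewrite src_comp.
have d3 : src (e 0) = tgt (whisk (e 1) (comp m (e 2) (e 3)) (e 4)).
  by rewrite tgt_whisk_top.
have d4 : src (whisk (e 1) (comp m (e 2) (e 3)) (e 4)) = tgt (e 5).
  by rewrite src_whisk_top.
have d5 : src (whisk (e 0) (e 1) (e 2)) = tgt (whisk (e 3) (e 4) (e 5)).
  by rewrite src_whisk_top ?tgt_whisk_top.
have /(nt_homot F) : homot (comp m (whisk (e 0) (e 1) (e 2)) (whisk (e 3) (e 4) (e 5)))
    (whisk (e 0) (whisk (e 1) (comp m (e 2) (e 3)) (e 4)) (e 5)).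
  apply: lift_chain; split; first by rewrite src_comp // !src_whisk_top.
  by rewrite tgt_comp // !tgt_whisk_top.
have FE k : k <= 5 -> F _ (e k) = x k by apply: Fx.
rewrite nt_comp ?sr1 ?tr1 // !nt_whisk //; try exact: whiskerable_top.
by rewrite nt_comp ?sr1 ?tr1 // !FE.
Qed.

Lemma whisk_unit (G : presheaf C) (HG : is_infty_groupoid G) m (a b : cell G m.+1) :
  src a = tgt b -> homot (whisk a (ps_map G (kappa P m) (src a)) b) (comp m a b).
Proof.
move=> ab; pose x k := match k with 0 => a | _ => b end.
have [|F Fx] := @chain_map 1 m G HG x; first by case.
pose Z := yo (gsum C (chain 1 m)).
have HZ : is_infty_groupoid Z := yo_infty_groupoid _.
pose e k : cell Z m.+1 := geps C (chain 1 m) k.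
have c0 : src (e 0) = tgt (e 1) by apply: chain_src_tgt.
have d0 : src (e 0) = tgt (ps_map Z (kappa P m) (src (e 0))) by rewrite tgt_kappa.
have d1 : src (ps_map Z (kappa P m) (src (e 0))) = tgt (e 1) by rewrite src_kappa.
have /(nt_homot F) : homot (whisk (e 0) (ps_map Z (kappa P m) (src (e 0))) (e 1))
    (comp m (e 0) (e 1)).
  apply: lift_chain; split; first by rewrite src_whisk_top // src_comp.
  by rewrite tgt_whisk_top // tgt_comp.
have FE k : k <= 1 -> F _ (e k) = x k by apply: Fx.
rewrite nt_whisk //; last exact: whiskerable_top.
by rewrite nt_comp ?sr1 ?tr1 // nt_nat nt_src !FE.
Qed.

(** * Isomorphisms of homotopy groups *)

Lemma pi_group_iso_comp (G : presheaf C) (HG : is_infty_groupoid G) m (u v y : cell G m) f f' :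
  pi_group_iso P u v f -> pi_group_iso P v y f' ->
  pi_group_iso P u y (fun a => f' (f a)).
Proof.
move=> [fl [fh [fi [fs fc]]]] [gl [gh [gi [gs gc]]]]; split; [|split; [|split; [|split]]].
- by move=> a la; apply/gl/fl.
- by move=> a b la lb ab; apply: gh; [apply: fl..|apply: fh].
- by move=> a b la lb ab; apply: fi => //; apply: gi => //; apply: fl.
- move=> c lc; have [b [lb bc]] := gs c lc; have [a [la ab]] := fs b lb.
  exists a; split=> //; apply: (homot_trans HG _ bc).
  by apply: gh => //; apply: fl.
- move=> a b c c' la lb abc abc'.
  have [sa ta] := fl a la; have [sb tb] := fl b lb.
  have fab : src (f a) = tgt (f b) by rewrite sa tb.
  have cfab : is_comp P (ltnSn m) (f a) (f b) (comp m (f a) (f b)).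
    by apply: comp_is_comp; rewrite ?sr1 ?tr1.
  have lc : loop u c.
    have ab : src a = tgt b by rewrite la.1 lb.2.
    by rewrite (is_comp_comp HG abc); split; rewrite ?src_comp ?tgt_comp ?lb.1 ?la.2.
  apply: (homot_trans HG (b := f' (comp m (f a) (f b)))).
    apply: gh; [exact: fl| |exact: fc cfab].
    by split; rewrite ?src_comp ?tgt_comp.
  by apply: gc abc' => //; apply: fl.
Qed.

(** Loops at [u] are the cells parallel to its unit, so bijectivity on classes is [whisk_bij_at] at
    that unit. *)
Lemma whisk_loops (G : presheaf C) (HG : is_infty_groupoid G) j m (u y : cell G m)
    (d g : cell G j.+1) : j <= m ->
  (forall a, loop u a -> whiskerable d a g /\ loop y (whisk d a g)) ->
  (forall a b, loop u a -> loop u b ->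
     homot (whisk d (comp m a b) g) (comp m (whisk d a g) (whisk d b g))) ->
  pi_group_iso P u y (fun a => whisk d a g).
Proof.
move=> jm wu hom.
have lk : loop u (ps_map G (kappa P m) u) by apply/loop_par.
have [inj sur] := whisk_bij_at HG jm (wu _ lk).1.
split; [|split; [|split; [|split]]].
- by move=> a /wu[].
- by move=> a b /wu[wa _] _; apply: homot_whisk.
- by move=> a b /loop_par la /loop_par lb; apply: inj.
- move=> c [sc tc]; have [sk tk] := (wu _ lk).2.
  have [|a [/loop_par la ac]] := sur c; first by split; rewrite ?sc ?tc ?sk ?tk.
  by exists a.
- move=> a b c c' la lb /(is_comp_comp HG) -> /(is_comp_comp HG) ->.
  exact: hom.
Qed.

(** Below the top level whiskering commutes with source and target, which moves the base point, and
    [whisk_comp] gives multiplicativity. *)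
Lemma whisk_pi_iso (G : presheaf C) (HG : is_infty_groupoid G) l m (u : cell G m)
  (d g : cell G l.+1) : l < m -> whiskerable d u g ->
  pi_group_iso P u (whisk d u g) (fun a => whisk d a g).
Proof.
move=> lm du.
have wu a : loop u a -> whiskerable d a g.
  by case=> sa _; apply: whiskerable_homot => //; rewrite sa.
apply: whisk_loops => //; first exact: ltnW.
  move=> a la; have wa := wu a la; split=> //.
  by case: la => sa ta; split; rewrite ?src_whisk ?tgt_whisk ?sa ?ta.
move=> a b la lb; apply: whisk_comp => //; first by rewrite la.1 lb.2.
  exact: (wu a la).1.
exact: (wu b lb).2.
Qed.

(** At the top level whiskering is conjugation: in the product [d a g d b g] the inner [g d] becomes
    a unit and is absorbed. *)
Lemma conj_pi_iso (G : presheaf C) (HG : is_infty_groupoid G) m (u v : cell G m)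
  (d g : cell G m.+1) : src d = u -> tgt d = v -> src g = v -> tgt g = u ->
  homot (comp m g d) (ps_map G (kappa P m) u) ->
  pi_group_iso P u v (fun a => whisk d a g).
Proof.
move=> sd td sg tg gd; apply: whisk_loops => //.
  move=> a [sa ta]; have h1 : src d = tgt a by rewrite sd ta.
  have h2 : src a = tgt g by rewrite sa tg.
  split; first exact: whiskerable_top.
  by split; rewrite ?src_whisk_top ?tgt_whisk_top.
move=> a b [sa ta] [sb tb].
have ab : src a = tgt b by rewrite sa tb.
have da : src d = tgt a by rewrite sd ta.
have ag : src a = tgt g by rewrite sa tg.
have gd' : src g = tgt d by rewrite sg td.
have db : src d = tgt b by rewrite sd tb.
have bg : src b = tgt g by rewrite sb tg.
apply: homot_sym; apply: (homot_trans HG (comp_whisk_whisk HG da ag gd' db bg)).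
have m1 : src a = tgt (comp m g d) by rewrite tgt_comp.
have m2 : src (comp m g d) = tgt b by rewrite src_comp.
apply: homot_whisk => //.
  by apply: whiskerable_top; rewrite ?tgt_whisk_top ?src_whisk_top.
apply: (homot_trans HG (b := whisk a (ps_map G (kappa P m) (src a)) b)); last exact: whisk_unit.
by rewrite sa; apply: homot_whisk => //; apply: whiskerable_top.
Qed.

(** * Transport of the base point along coherence arrows *)

Lemma sr_sr (G : presheaf C) i l m (a : cell G m) : i <= l -> l <= m ->
  sr i (sr l a) = sr i a.
Proof.
move=> il; elim: m a => [|m IH] a; first by case: l il => // _ _; rewrite srr.
rewrite leq_eqVlt => /predU1P[lm|lm]; first by subst l; rewrite srr.
by rewrite (sr_src a lm) IH // -sr_src // (leq_trans il).
Qed.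

Lemma tr_tr (G : presheaf C) i l m (a : cell G m) : i <= l -> l <= m ->
  tr i (tr l a) = tr i a.
Proof.
move=> il; elim: m a => [|m IH] a; first by case: l il => // _ _; rewrite trr.
rewrite leq_eqVlt => /predU1P[lm|lm]; first by subst l; rewrite trr.
by rewrite (tr_tgt a lm) IH // -tr_tgt // (leq_trans il).
Qed.

Lemma tr_sr (G : presheaf C) i l m (a : cell G m) : i < l -> l <= m ->
  tr i (sr l a) = tr i a.
Proof.
move=> il; elim: m a => [|m IH] a; first by case: l il.
rewrite leq_eqVlt => /predU1P[lm|lm]; first by subst l; rewrite srr.
by rewrite (sr_src a lm) IH // -tr_src // (leq_trans il).
Qed.

Lemma sr_tr (G : presheaf C) i l m (a : cell G m) : i < l -> l <= m ->
  sr i (tr l a) = sr i a.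
Proof.
move=> il; elim: m a => [|m IH] a; first by case: l il.
rewrite leq_eqVlt => /predU1P[lm|lm]; first by subst l; rewrite trr.
by rewrite (tr_tgt a lm) IH // -sr_tgt // (leq_trans il).
Qed.

Lemma glob_parallel_sym n (X : C) (f g : Hom (D n) X) :
  glob_parallel f g -> glob_parallel g f.
Proof. by case: n f g => // n f g []; split. Qed.

Definition agree_below (G : presheaf C) l m (f g : cell G m) : Prop :=
  forall i, i < l -> sr i f = sr i g /\ tr i f = tr i g.

Lemma agree_parallel p l m (f g : cell (yo (D p)) m) : l <= m -> agree_below l f g ->
  glob_parallel (sr l f) (sr l g) /\ glob_parallel (tr l f) (tr l g).
Proof.
case: l => // l lm fg; have [fgs fgt] := fg l (ltnSn l).
split; split.
- by change (src (sr l.+1 f) = src (sr l.+1 g)); rewrite -!sr1 !sr_sr.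
- by change (tgt (sr l.+1 f) = tgt (sr l.+1 g)); rewrite -!tr1 !tr_sr.
- by change (src (tr l.+1 f) = src (tr l.+1 g)); rewrite -!sr1 !sr_tr.
- by change (tgt (tr l.+1 f) = tgt (tr l.+1 g)); rewrite -!tr1 !tr_tr.
Qed.

(** By Yoneda, [f] and [g] are natural operations from [p]-cells to [m]-cells, each giving a base
    point for every [x]. Naturality is a strict equality on representatives. *)
Definition natural_pi_iso p m (f g : Hom (D m) (D p)) : Prop :=
  exists phi : forall G : presheaf C, cell G p -> cell G m.+1 -> cell G m.+1,
    (forall (G : presheaf C) (HG : is_infty_groupoid G) (x : cell G p),
       pi_group_iso P (ps_map G f x) (ps_map G g x) (phi G x)) /\
    (forall (G G' : presheaf C) (HG : is_infty_groupoid G) (HG' : is_infty_groupoid G')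
       (F : nat_trans G G') x a, loop (ps_map G f x) a ->
       F _ (phi G x a) = phi G' (F _ x) (F _ a)).

(** Induction on [r = m - l]. The bound [p <= l.+1] makes parallel pairs [D_l -> D_p] admissible,
    and it persists as [l] grows. *)
Lemma natural_pi_iso_agree r l m p (f g : cell (yo (D p)) m) :
  m = r + l -> p <= l.+1 -> agree_below l f g -> natural_pi_iso f g.
Proof.
have HY := @yo_infty_groupoid (D p).
elim: r l f g => [|r IH] l f g mr pl fg.
  (* Now [f] and [g] are parallel: conjugation by liftings [d] from [f] to [g] and [e] back applies,
     a further lifting joining [e d] to the unit of [f]. *)
  rewrite add0n in mr; subst l; have [] := agree_parallel (leqnn m) fg.
  rewrite !srr => fg' _.
  have gf' := glob_parallel_sym fg'.
  have [d [sd td]] := lift_disk pl fg'; have [e [se te]] := lift_disk pl gf'.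
  have ed : src e = tgt d by rewrite se td.
  have [w we] : homot (comp m e d) (ps_map (yo (D p)) (kappa P m) f).
    apply: lift_disk; first exact: leqW.
    split.
    - change (src (comp m e d) = src (ps_map (yo (D p)) (kappa P m) f)).
      by rewrite src_kappa src_comp.
    - change (tgt (comp m e d) = tgt (ps_map (yo (D p)) (kappa P m) f)).
      by rewrite tgt_kappa tgt_comp.
  exists (fun G x a => whisk (ps_map G d x) a (ps_map G e x)); split.
    move=> G HG x; pose F := yo_pt x.
    apply: conj_pi_iso => //; rewrite /src /tgt -?ps_comp ?[compC d _]sd ?[compC d _]td
      ?[compC e _]se ?[compC e _]te //.
    have := nt_homot F (ex_intro _ w we).
    by rewrite nt_comp ?sr1 ?tr1 // nt_nat.
  move=> G G' HG HG' F x a [sa ta]; rewrite nt_whisk ?nt_nat //.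
  apply: whiskerable_top; rewrite ?sa ?ta /src /tgt -?ps_comp.
    by rewrite [compC d _]sd.
  by rewrite [compC e _]te.
have lm : l < m by rewrite mr addSn ltnS leq_addl.
have [fgs fgt] := agree_parallel (ltnW lm) fg.
have gfs := glob_parallel_sym fgs.
(* [d] goes from the target of [f] to that of [g], and [e] from the source of [g] to that of [f], so
   [whisk d f e] agrees with [g] below [l.+1]. *)
have [d [sd td]] := lift_disk pl fgt; have [e [se te]] := lift_disk pl gfs.
have wf : whiskerable d f e by split; rewrite ?sd ?te.
have [|||phi [iso nat]] := IH l.+1 (whisk d f e) g.
- by rewrite mr addSnnS.
- exact: leqW.
- move=> i; rewrite ltnS leq_eqVlt => /predU1P[->|il].
    by rewrite sr_whisk // tr_whisk // se td.
  have il' := ltnW il; have lm' := ltnW lm.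
  rewrite -(sr_sr _ il' lm') -(tr_tr _ il' lm') sr_whisk // tr_whisk // se td.
  by rewrite sr_sr // tr_tr.
have wfx G (x : cell G p) : whiskerable (ps_map G d x) (ps_map G f x) (ps_map G e x).
  exact: (nt_whiskerable (yo_pt x) wf).
exists (fun G x a => phi G x (whisk (ps_map G d x) a (ps_map G e x))).
have Ewf G (HG : is_infty_groupoid G) (x : cell G p) : ps_map G (whisk d f e) x =
    whisk (ps_map G d x) (ps_map G f x) (ps_map G e x).
  exact: (nt_whisk HY HG (yo_pt x) lm wf).
have isow G (HG : is_infty_groupoid G) (x : cell G p) :
  pi_group_iso P (ps_map G f x) (ps_map G (whisk d f e) x)
    (fun a => whisk (ps_map G d x) a (ps_map G e x)).
  by rewrite Ewf //; apply: whisk_pi_iso.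
split.
  by move=> G HG x; apply: (pi_group_iso_comp HG (isow G HG x) (iso G HG x)).
move=> G G' HG HG' F x a la; rewrite (nat G G' HG HG') //; last exact: (isow G HG x).1.
rewrite (nt_whisk HG HG' F (leqW lm)) ?nt_nat //.
by apply: whiskerable_homot => //; rewrite la.1.
Qed.

Lemma pi_group_iso_id (G : presheaf C) (HG : is_infty_groupoid G) m (u : cell G m) :
  pi_group_iso P u u id.
Proof.
do 3!split=> //; split=> [c lc|a b c c' _ _ abc abc'].
  by exists c; split=> //; apply: homot_refl.
rewrite (is_comp_comp HG abc) (is_comp_comp HG abc'); exact: homot_refl.
Qed.

(** The universal [y] is the identity of [D_{j+1}]. Both iterated units have the boundary of [y]
    below [j], and with [l = j] the bound [p <= l.+1] is an equality. *)
Lemma natural_pi_iso_unit j m : j < m ->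
  exists phi : forall G : presheaf C, cell G j.+1 -> cell G m.+1 -> cell G m.+1,
    (forall (G : presheaf C) (HG : is_infty_groupoid G) (y : cell G j.+1),
       pi_group_iso P (kk m y) (kk m (src y)) (phi G y)) /\
    (forall (G G' : presheaf C) (HG : is_infty_groupoid G) (HG' : is_infty_groupoid G')
       (F : nat_trans G G') y a, loop (kk m y) a ->
       F _ (phi G y a) = phi G' (F _ y) (F _ a)).
Proof.
move=> jm; pose x : cell (yo (D j.+1)) j.+1 := idC (D j.+1).
have [|||phi [iso nat]] :=
    @natural_pi_iso_agree (m - j) j m j.+1 (kk m x) (kk m (src x)).
- by rewrite subnK // ltnW.
- by [].
- move=> i ij; have ij' := ltnW ij.
  rewrite !sr_kk ?tr_kk ?(ltnW jm) ?leqW //.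
  by rewrite -sr_src // -tr_src.
have E G (y : cell G j.+1) : ps_map G (kk m x) y = kk m y.
  by rewrite [LHS](nt_kk (yo_pt y)) /= ps_id.
have E' G (y : cell G j.+1) : ps_map G (kk m (src x)) y = kk m (src y).
  by rewrite [LHS](nt_kk (yo_pt y)) nt_src /= ps_id.
exists phi; split=> [G HG y|G G' HG HG' F y a la].
  by rewrite -E -E'; apply: iso.
by apply: nat => //; rewrite E.
Qed.

(** Induction on [r = m - j], from the identity at [j = m]; each step composes with
    [natural_pi_iso_unit] at [y = sr j.+1 u]. *)
Lemma natural_pi_iso_src r j m : m = r + j ->
  exists phi : forall G : presheaf C, cell G m -> cell G m.+1 -> cell G m.+1,
    (forall (G : presheaf C) (HG : is_infty_groupoid G) (u : cell G m),
       pi_group_iso P u (kk m (sr j u)) (phi G u)) /\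
    (forall (G G' : presheaf C) (HG : is_infty_groupoid G) (HG' : is_infty_groupoid G')
       (F : nat_trans G G') u a, loop u a ->
       F _ (phi G u a) = phi G' (F _ u) (F _ a)).
Proof.
elim: r j => [|r IH] j mr.
  rewrite add0n in mr; subst j; exists (fun G _ => id); split=> // G HG u.
  by rewrite srr kkk; apply: pi_group_iso_id.
have jm : j < m by rewrite mr addSn ltnS leq_addl.
have [|phi [iso nat]] := IH j.+1; first by rewrite mr addSnnS.
have [psi [iso' nat']] := natural_pi_iso_unit jm.
exists (fun G u a => psi G (sr j.+1 u) (phi G u a)); split=> [G HG u|].
  rewrite -(sr_sr u (leqnSn j) jm) sr1.
  exact: (pi_group_iso_comp HG (iso G HG u) (iso' G HG _)).
move=> G G' HG HG' F u a la; rewrite (nat' G G' HG HG'); last exact: (iso G HG u).1.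
by rewrite nt_sr (nat G G' HG HG').
Qed.

End Coherence.

Lemma kk_kit (G : presheaf C) m (x : cell G 0) : kk m x = kit P m x.
Proof. by elim: m => [|m IH] /=; rewrite ?kkk // kkS // IH. Qed.

End Cells.

Theorem theorem4 (C : GlobExt) (HC : contractible C) (P : pregroupoidal C) (m : nat) :
  exists phi : forall G : presheaf C, is_infty_groupoid G ->
                 G (Dn (GGlobe C) m) -> G (Dn (GGlobe C) m.+1) -> G (Dn (GGlobe C) m.+1),
    (forall (G : presheaf C) (HG : is_infty_groupoid G) (u : G (Dn (GGlobe C) m)),
        pi_group_iso P u (kit P m (src0 u)) (phi G HG u)) /\
    (forall (G : presheaf C) (HG : is_infty_groupoid G)
            (G' : presheaf C) (HG' : is_infty_groupoid G')
            (F : nat_trans G G') (u : G (Dn (GGlobe C) m)) (a : G (Dn (GGlobe C) m.+1)),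
        loop u a ->
        homot (phi G' HG' (F _ u) (F _ a)) (F _ (phi G HG u a))).
Proof.
have [phi [iso nat]] := natural_pi_iso_src P HC (esym (addn0 m)).
exists (fun G _ => phi G); split=> [G HG u|G HG G' HG' F u a la].
  rewrite -kk_kit /src0 (sgmE P); exact: iso.
(* Naturality is strict on representatives, so the homotopy is a unit. *)
rewrite -(nat G G' HG HG') //; exact: (homot_refl P).
Qed.
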